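(* If $\mu$ is a measure on a doubling metric space $X$ and $\Lambda>1$, then $$\overline{\dim}_{\mathrm{loc}}(\mu,x)\le \dim_{\mathrm{hom}}^{\Lambda}(\mu,x)$$ for $\mu$-almost all $x\in X$.
   Context: Let $(X,d)$ be a metric space. $B(x,r)=\{y\in X: d(x,y)\le r\}$ denotes the closed ball; each ball comes with a fixed centre and radius. $X$ is doubling if there is $N\in\mathbb{N}$ such that every closed ball $B(x,r)$ can be covered by $N$ balls of radius $r/2$. A measure on $X$ means a nontrivial Borel regular outer measure defined on all subsets of $X$ such that bounded sets have finite measure. The upper local dimension is $\overline{\dim}_{\mathrm{loc}}(\mu,x)=\limsup_{r\downarrow0}\log\mu(B(x,r))/\log r$. A $\delta$-packing of a set $A\subset X$ is a countable collection of pairwise disjoint closed balls of radius $\delta$ with centres in $A$. For $x\in X$, $\delta,\varepsilon,r>0$ and $\Lambda>1$ let $$\hom_{\delta,\varepsilon,r}^{\Lambda}(\mu,x)=\sup\{\#\mathcal{B}: \mathcal{B}\text{ is a }(\delta r)\text{-packing of }B(x,r)\text{ with }\mu(B)>\varepsilon\mu(B(x,\Lambda r))\text{ for all }B\in\mathcal{B}\},$$ $$\hom_\delta^\Lambda(\mu,x)=\lim_{\varepsilon\downarrow0}\limsup_{r\downarrow0}\hom_{\delta,\varepsilon,r}^{\Lambda}(\mu,x),\qquad \dim_{\mathrm{hom}}^\Lambda(\mu,x)=\liminf_{\delta\downarrow0}\frac{\log\hom_\delta^\Lambda(\mu,x)}{-\log\delta},$$ where in the last formula $\log 0$ is interpreted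 as $0$. *)

(* Defs.v *)
From mathcomp Require Import all_boot all_order all_algebra.
From mathcomp Require Import all_classical all_reals all_analysis.

Set Implicit Arguments.
Unset Strict Implicit.
Unset Printing Implicit Defensive.

Import Order.TTheory GRing.Theory Num.Theory.
Import numFieldNormedType.Exports.

Local Open Scope classical_set_scope.
Local Open Scope ring_scope.
Local Open Scope ereal_scope.

(* The library's [closed_ball] is the closure of the open ball, which in a
   general metric space can be strictly smaller than {y | d(x,y) <= r}. *)
Definition cball (R : realType) (X : metricType R) (x : X) (r : R) : set X :=
  [set y | (mdist x y <= r)%R].

(* The N centres need not be distinct, so this means "at most N balls". *)
Definition doubling (R : realType) (X : metricType R) : Prop :=
  exists N : nat, forall (x : X) (r : R), (0 < r)%R ->
    exists c : 'I_N -> X,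
      cball x r `<=` \bigcup_(i in [set: 'I_N]) cball (c i) (r / 2)%R.

Definition metric_bounded (R : realType) (X : metricType R) (A : set X) : Prop :=
  exists (x : X) (r : R), A `<=` cball x r.

Definition borel (R : realType) (X : metricType R) : set (set X) :=
  <<s [set U : set X | open U] >>.
Arguments borel {R} X.

Definition borel_regular (R : realType) (X : metricType R)
    (mu : {outer_measure set X -> \bar R}) : Prop :=
  (forall B : set X, borel X B -> mu.-caratheodory B) /\
  (forall A : set X, exists B : set X, [/\ borel X B, A `<=` B & mu B = mu A]).

Definition is_measure_on (R : realType) (X : metricType R)
    (mu : {outer_measure set X -> \bar R}) : Prop :=
  [/\ mu [set: X] != 0,
      borel_regular mu &
      forall A : set X, metric_bounded A -> mu A < +oo].

(* [lne 0 = -oo], so the quotient is +oo when mu (B(x,r)) = 0 and r < 1. *)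
Definition upper_local_dim (R : realType) (X : metricType R)
    (mu : {outer_measure set X -> \bar R}) (x : X) : \bar R :=
  limf_esup (fun r : R => lne (mu (cball x r)) / (ln r)%:E) 0^'+.

(* A packing is given by the set C of the centres of its balls: as balls carry
   their centre and all have the same positive radius, the balls and their
   centres correspond one to one. *)
Definition packing (R : realType) (X : metricType R) (delta : R) (A C : set X)
    : Prop :=
  [/\ countable C, C `<=` A & trivIset C (fun c : X => cball c delta)].

Definition hom_at (R : realType) (X : metricType R)
    (mu : {outer_measure set X -> \bar R}) (Lambda delta eps r : R) (x : X)
    : \bar R :=
  ereal_sup [set counting C | C in
    [set C : set X | packing (delta * r)%R (cball x r) C /\
       forall c : X, C c ->
         eps%:E * mu (cball x (Lambda * r)%R) < mu (cball c (delta * r)%R)]].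

Definition hom (R : realType) (X : metricType R)
    (mu : {outer_measure set X -> \bar R}) (Lambda delta : R) (x : X) : \bar R :=
  lim (limf_esup (fun r : R => hom_at mu Lambda delta eps r x) 0^'+
         @[eps --> 0^'+]).

Definition log0 (R : realType) (t : \bar R) : \bar R :=
  if t == 0 then 0 else lne t.

Definition dim_hom (R : realType) (X : metricType R)
    (mu : {outer_measure set X -> \bar R}) (Lambda : R) (x : X) : \bar R :=
  limf_einf (fun delta : R => log0 (hom mu Lambda delta x) / (- ln delta)%:E)
    0^'+.

(* Main.v *)
Require Import Defs.
From mathcomp Require Import finmap all_boot all_order all_algebra.
From mathcomp Require Import all_classical all_reals all_analysis.
From mathcomp Require Import lra ring.

(** Let s < t, and suppose that x satisfies dim_hom < s and t < upper_local_dim.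
    The first inequality gives arbitrarily small delta such that, whatever
    epsilon, every small ball B(x,r) contains at most M = delta^(-s) disjoint
    balls of radius delta r that are heavy, that is, of mass more than
    epsilon mu(B(x,Lambda r)).  The second one says that mu(B(x,rho)) < rho^t
    for arbitrarily small rho.  For fixed s, t, delta, epsilon the set of such
    points is shown to be null by a branching argument.

    Let A be the set of points where the packing bound holds at all scales
    r < r0.  For x in A, the set A n B(x,r/2) is covered by C M balls of radius
    delta r / 2, where C depends only on the doubling constant and Lambda,
    together with boundedly many light ones: those have mass at most
    C epsilon mu(B(x,Lambda r)), even after enlarging them by the factor Lambda
    (lemma heavy_light_cover).  Both sorts are centred in A, so the covering can
    be iterated.  Fix p in (0,1).  In one step the sum of the p-th powers of the
    masses grows at most by the factor C M + C' (C epsilon)^p, which is at most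
    G = 2 C M when epsilon is small, although the number C' of light balls is
    far larger than M.  After k steps, estimating
    mu(Q) <= beta^(1-p) mu(Q)^p for the balls of mass at most beta, the points
    of A whose ball of radius about delta^k has mass at most beta = delta^(t k)
    form a set of measure at most a constant times (G delta^(t(1-p)))^k (lemma
    thin_points_le).  If p is chosen with t (1-p) > s and delta is small, this
    is a convergent geometric series, and the Borel-Cantelli lemma concludes
    (lemmas frequently_thin_null and low_hom_null).

    There remains to reduce to countably many parameters.  The numbers s and t
    can be taken rational, and the scale delta can be replaced by a rational d in
    (delta, 2 delta): a packing of B(x,r) with radius d r is a packing of the
    larger ball of radius (d / delta) r, with radius delta times as large.
    Doubling Lambda absorbs the change of the reference ball (lemma
    hom_lt_low_hom). *)

Import Order.TTheory GRing.Theory Num.Theory.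
Import numFieldNormedType.Exports.

Set Implicit Arguments.
Unset Strict Implicit.

Local Open Scope classical_set_scope.
Local Open Scope ring_scope.

(** * Coverings and packings in doubling spaces *)

Definition covers {R : realType} {X : metricType R} (s : seq X) (rho : R)
    (A : set X) : Prop :=
  forall y, A y -> exists2 c, c \in s & mdist c y <= rho.

Definition ball_covers {R : realType} (X : metricType R) (N : nat) : Prop :=
  forall j (x : X) (r : R), 0 < r ->
    exists2 s : seq X, (size s <= N ^ j)%N & covers s (r / 2 ^+ j) (cball x r).

Lemma doubling_ball_covers (R : realType) (X : metricType R) :
  doubling X -> exists N, ball_covers X N.
Proof.
move=> [N cov]; exists N; elim=> [|j IH] x r r0.
  exists [:: x] => // y; rewrite /cball/= => xy.
  by exists x; rewrite ?mem_head// expr0 divr1.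
have [s ss cs] := IH x r r0.
have rj0 : 0 < r / 2 ^+ j by rewrite divr_gt0// exprn_gt0.
have [f fP] := choice (fun c => cov c _ rj0).
exists [seq f c i | c <- s, i <- enum 'I_N].
  by rewrite size_allpairs size_enum_ord expnSr leq_mul2r ss orbT.
move=> y /cs[c cins cy].
have [i _ iy] := fP c y cy.
exists (f c i); first by apply: allpairs_f => //; rewrite mem_enum.
by move: iy; rewrite /cball/= exprSr invfM mulrA.
Qed.

(** The homogeneity bound is known only at the points of a given set A, so
    iterating a covering requires centres in A; moving each centre into A costs
    a factor 2 in the radius. *)
Lemma covers_recentre (R : realType) (X : metricType R) (s : seq X) (rho : R)
    (A : set X) :
  covers s rho A -> exists s' : seq X,
    [/\ (size s' <= size s)%N, forall c, c \in s' -> A c & covers s' (rho *+ 2) A].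
Proof.
move=> cs.
pose g c := if pselect (exists y, A y /\ mdist c y <= rho) is left p
  then Some (projT1 (cid p)) else None.
exists (pmap g s); split.
- by rewrite size_pmap count_size.
- move=> c; rewrite mem_pmap => /mapP[z _].
  rewrite /g; case: pselect => // p [->].
  by case: (projT2 (cid p)).
- move=> y Ay; have [c cs' cy] := cs y Ay.
  have p : exists y, A y /\ mdist c y <= rho by exists y.
  exists (projT1 (cid p)).
    rewrite mem_pmap; apply/mapP; exists c => //.
    rewrite /g; case: pselect => // q.
    by rewrite (Prop_irrelevance p q).
  have [_ cz] := projT2 (cid p).
  apply: le_trans (metric_triangle _ c _) _.
  by rewrite metric_sym mulr2n lerD.
Qed.

Lemma ball_covers_recentre (R : realType) (X : metricType R) N j (x : X) (r : R)
    (A : set X) : ball_covers X N -> 0 < r -> A `<=` cball x r ->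
  exists s : seq X,
    [/\ (size s <= N ^ j)%N, forall c, c \in s -> A c
      & covers s (r / 2 ^+ j *+ 2) A].
Proof.
move=> cov r0 Axr; have [s ss cs] := cov j x r r0.
have [|s' [s's s'A cs']] := @covers_recentre _ _ s (r / 2 ^+ j) A.
  by move=> y /Axr /cs.
by exists s'; split=> //; exact: leq_trans ss.
Qed.

(** The centres of a packing of largest cardinality form the covering: a point at
    distance more than 2 rho from all of them could be added to the packing. *)
Lemma maximal_packing_covers (R : realType) (X : metricType R) (Y : set X)
    (rho : R) (m : nat) : 0 <= rho ->
  (forall s : seq X, uniq s -> (forall c, c \in s -> Y c) ->
     trivIset [set` s] (fun c => cball c rho) -> (size s <= m)%N) ->
  exists2 s : seq X, (size s <= m)%N & covers s (rho *+ 2) Y.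
Proof.
move=> rho0 bnd.
pose sep (s : seq X) := [/\ uniq s, (forall c, c \in s -> Y c) &
  trivIset [set` s] (fun c => cball c rho)].
pose P n := `[< exists2 s, sep s & size s = n >].
have P0 : exists n, P n.
  by exists 0%N; apply/asboolP; exists [::].
have Pm n : P n -> (n <= m)%N.
  by move=> /asboolP[s [us sY ts] <-]; exact: bnd.
have [n /asboolP[s [us sY ts] sn] maxn] := ex_maxnP P0 Pm.
exists s; first by apply: bnd.
move=> y Yy; apply: contrapT => ncov.
have far c : c \in s -> rho *+ 2 < mdist c y.
  by move=> cs; rewrite ltNge; apply/negP => cy; apply: ncov; exists c.
have ys : y \notin s.
  by apply/negP => /far; rewrite mdistxx; apply/negP; rewrite -leNgt mulrn_wge0.
have disj c : c \in s -> ~ (cball c rho `&` cball y rho !=set0).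
  move=> /far + [z [/= cz yz]]; apply/negP; rewrite -leNgt.
  apply: le_trans (metric_triangle _ z _) _.
  by rewrite mulr2n lerD// metric_sym.
suff /maxn : P (size s).+1 by rewrite sn ltnn.
apply/asboolP; exists (y :: s) => //; split.
- by rewrite /= ys us.
- by move=> c; rewrite in_cons => /orP[/eqP->//|/sY].
- move=> i j /=; rewrite !in_cons => /orP[/eqP->|iS] /orP[/eqP->|jS] //.
  + by rewrite setIC => /disj; case/(_ jS).
  + by move=> /disj; case/(_ iS).
  + by apply: ts.
Qed.

Lemma counting_seq (R : realType) (T : choiceType) (s : seq T) :
  uniq s -> @counting T R [set` s] = (size s)%:R%:E.
Proof.
move=> us; rewrite /counting asboolT; last exact: finite_seq.
congr (_%:R%:E).
rewrite (_ : [set` s] = [set` [fset x | x in s]%fset]).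
  by rewrite set_fsetK card_fseq undup_id.
by apply/seteqP; split=> x /=; rewrite inE.
Qed.

(** * Null sets of outer measures *)

Lemma outer_measure_seq_le (R : realType) (T : choiceType)
    (mu : {outer_measure set T -> \bar R}) (s : seq T) (F : T -> set T)
    (g : T -> R) (A : set T) :
  (forall y, A y -> exists2 c, c \in s & F c y) ->
  (forall c, c \in s -> (mu (F c) <= (g c)%:E)%E) ->
  (mu A <= (\sum_(c <- s) g c)%:E)%E.
Proof.
elim: s A => [|c s IH] A AF Fg.
  rewrite big_nil (_ : A = set0) ?outer_measure0//.
  by apply/seteqP; split => // y /AF[].
rewrite big_cons EFinD.
apply: (@le_trans _ _ (mu (F c `|` A `\` F c))).
  apply: le_outer_measure => y Ay.
  by have [?|?] := pselect (F c y); [left|right].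
apply: le_trans (outer_measureU2 _ _ _) _.
apply: leeD; first by apply: Fg; rewrite mem_head.
apply: IH => [y [/AF[z]]|z zs]; last by apply: Fg; rewrite in_cons zs orbT.
by rewrite in_cons => /orP[/eqP-> //|zs Fz _]; exists z.
Qed.

Lemma outer_measure_le0 (R : realType) (T : Type)
    (mu : {outer_measure set T -> \bar R}) (A : set T) :
  (mu A <= 0)%E -> mu A = 0%E.
Proof. by move=> A0; apply/eqP; rewrite eq_le A0 outer_measure_ge0. Qed.

Lemma outer_measure_bigcup0 (R : realType) (T : Type) (I : countType)
    (mu : {outer_measure set T -> \bar R}) (F : I -> set T) :
  (forall i, mu (F i) = 0%E) -> mu (\bigcup_i F i) = 0%E.
Proof.
move=> F0; apply: outer_measure_le0.
pose G n := if unpickle n is Some i then F i else set0.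
apply: (@le_trans _ _ (mu (\bigcup_n G n))).
  apply: le_outer_measure => y [i _ Fiy].
  by exists (pickle i) => //; rewrite /G pickleK.
apply: le_trans (outer_measure_sigma_subadditive mu G) _.
rewrite eseries0// => n _ _; rewrite /G.
by case: unpickle => [i|]; rewrite ?F0 ?outer_measure0.
Qed.

Lemma exists_expr_lt (R : realType) (q e : R) : 0 <= q -> q < 1 -> 0 < e ->
  exists n, q ^+ n < e.
Proof.
move=> q0 q1 e0.
have : q ^+ n @[n --> \oo] --> (0 : R) by apply: cvg_expr; rewrite ger0_norm.
move=> /cvgrPdist_lt /(_ e e0)[n _ /(_ n (leqnn n))] /=.
by rewrite sub0r normrN ger0_norm ?exprn_ge0// => ?; exists n.
Qed.

Lemma outer_measure_borel_cantelli (R : realType) (T : Type)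
    (mu : {outer_measure set T -> \bar R}) (F : nat -> set T) (K q : R) :
  0 <= K -> 0 <= q -> q < 1 -> (forall k, (mu (F k) <= (K * q ^+ k)%:E)%E) ->
  mu [set y | forall n, exists2 k, (n <= k)%N & F k y] = 0%E.
Proof.
move=> K0 q0 q1 FK; set S := (X in mu X).
have tail n : (mu S <= (K / (1 - q) * q ^+ n)%:E)%E.
  apply: (@le_trans _ _ (mu (\bigcup_(k in ~` `I_n) F k))).
    apply: le_outer_measure => y /(_ n)[k nk Fky]; exists k => //=.
    by apply/negP; rewrite -leqNgt.
  apply: le_trans (outer_measure_sigma_subadditive_tail mu n F) _.
  apply: lime_le.
    by apply: is_cvg_nneseries => *; exact: outer_measure_ge0.
  near=> m.
  apply: (@le_trans _ _ (\sum_(n <= i < m) (K * q ^+ i)%:E)%E).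
    by apply: lee_sum.
  rewrite sumEFin lee_fin -mulr_sumr -mulrA ler_wpM2l// mulrC.
  have nm : (n <= m)%N by near: m; exists n.
  rewrite -(subnKC nm) geometric_partial_tail geometric_seriesE ?lt_eqF//=.
  rewrite ler_wpM2r// ?invr_ge0 ?subr_ge0 ?(ltW q1)//.
  by rewrite ler_piMr ?exprn_ge0// gerBl exprn_ge0.
apply: outer_measure_le0; apply/lee_addgt0Pr => e e0; rewrite add0e.
have K1 : 0 <= K / (1 - q) by rewrite divr_ge0// subr_ge0 ltW.
have [|n qn] := @exists_expr_lt R q (e / (K / (1 - q) + 1)) q0 q1.
  by rewrite divr_gt0// ltr_wpDl.
apply: le_trans (tail n) _; rewrite lee_fin.
move: qn; rewrite ltr_pdivlMr ?ltr_wpDl// => /ltW; apply: le_trans.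
by rewrite mulrC ler_wpM2l ?exprn_ge0// lerDl.
Unshelve. all: by end_near. Qed.

(** * The branching estimate *)

Definition mass {R : realType} {X : metricType R}
    (mu : {outer_measure set X -> \bar R}) (x : X) (r : R) : R :=
  fine (mu (cball x r)).

Definition low_hom {R : realType} {X : metricType R}
    (mu : {outer_measure set X -> \bar R}) (L d e M r0 : R) : set X :=
  [set x | forall r, 0 < r < r0 -> (hom_at mu L d e r x <= M%:E)%E].

Definition thin_points {R : realType} {X : metricType R}
    (mu : {outer_measure set X -> \bar R}) (A : set X) (x : X)
    (rho t beta : R) : set X :=
  [set y | [/\ A y, mdist x y <= rho & mass mu y t <= beta]].

Definition frequently_thin {R : realType} {X : metricType R}
    (mu : {outer_measure set X -> \bar R}) (t : R) : set X :=
  [set y | forall eta : R, 0 < eta ->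
    exists2 rho, 0 < rho < eta & mass mu y rho < rho `^ t].

Section Branching.
Context {R : realType} {X : metricType R} (mu : {outer_measure set X -> \bar R}).
Context (finite_balls : forall x r, (mu (cball x r) < +oo)%E).

Lemma massE x r : mu (cball x r) = (mass mu x r)%:E.
Proof. by rewrite /mass fineK// ge0_fin_numE// outer_measure_ge0. Qed.

Lemma mass_ge0 x r : 0 <= mass mu x r.
Proof. by rewrite -lee_fin -massE outer_measure_ge0. Qed.

Lemma le_mass x y r r' : mdist y x + r <= r' -> mass mu x r <= mass mu y r'.
Proof.
move=> yxr; rewrite -lee_fin -!massE; apply: le_outer_measure => z /= xz.
by apply: le_trans yxr; apply: le_trans (metric_triangle _ x _) _; rewrite lerD2l.
Qed.

Context (N : nat) (cov : ball_covers X N).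

Lemma hom_at_packing_size L d e r x M (s : seq X) :
  (hom_at mu L d e r x <= M%:E)%E -> uniq s ->
  (forall c, c \in s ->
     mdist x c <= r /\ e * mass mu x (L * r) < mass mu c (d * r)) ->
  trivIset [set` s] (fun c => cball c (d * r)) -> (size s)%:R <= M.
Proof.
move=> hM us sP ts; rewrite -lee_fin -(@counting_seq R X)//.
apply: le_trans hM; apply: ereal_sup_ubound; exists [set` s] => //.
split; first split => //.
- by apply: finite_set_countable; exact: finite_seq.
- by move=> c /sP[].
- by move=> c /sP[_]; rewrite !massE -EFinM lte_fin.
Qed.

(** The homogeneity bound speaks of balls of radius d r, whereas the next step
    of the iteration refers to a ball L times as large.  Covering the latter by
    boundedly many of the former shows that it is light too. *)
Lemma light_mass_le L d e r x c a : 0 < L -> 0 < d -> 0 < r -> 0 <= e ->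
    L * 2 <= 2 ^+ a ->
  (forall y, mdist c y <= L * (d * r) ->
     mass mu y (d * r) <= e * mass mu x (L * r)) ->
  mass mu c (L * (d * r)) <= (N ^ a)%:R * e * mass mu x (L * r).
Proof.
move=> L0 d0 r0 e0 La light.
have Ldr0 : 0 < L * (d * r) by rewrite !mulr_gt0.
have [//|s [sN sc cs]] := @ball_covers_recentre _ _ N a c _
  (cball c (L * (d * r))) cov Ldr0.
have small : L * (d * r) / 2 ^+ a *+ 2 <= d * r.
  rewrite -mulr_natr mulrAC ler_pdivrMr ?exprn_gt0//.
  by rewrite mulrAC [leRHS]mulrC ler_pM2r ?mulr_gt0.
have := @outer_measure_seq_le _ _ mu s (fun y => cball y (d * r))
  (fun=> e * mass mu x (L * r)) (cball c (L * (d * r))).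
rewrite massE lee_fin => /(_ _ _)/le_trans; apply.
- by move=> y /cs[z zs zy]; exists z => //; exact: le_trans small.
- by move=> y /sc cy; rewrite massE lee_fin; exact: light.
- rewrite big_const_seq count_predT iter_addr addr0 -[leLHS]mulr_natl -mulrA.
  by rewrite ler_wpM2r ?ler_nat// mulr_ge0// mass_ge0.
Qed.

(** Points of A near a heavy ball lie close to one of the at most M members of
    a maximal packing by heavy balls, hence are covered by a number of balls
    proportional to M; this is the list H.  The remaining points of A are
    centres of light balls only, so any covering of them centred at such points
    can serve as S. *)
Lemma heavy_light_cover (A : set X) L d e M r x a b :
    1 <= L -> 0 < d -> 0 < r -> 0 <= e -> 0 <= M ->
    (L + 1) * d <= 1 / 2 -> (L + 3) * 4 <= 2 ^+ a -> 2 <= d * 2 ^+ b ->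
    (hom_at mu L d e r x <= M%:E)%E ->
  exists H S : seq X, [/\ (size H)%:R <= (N ^ a)%:R * M, (size S <= N ^ b)%N,
    forall c, c \in H ++ S -> A c /\ mdist x c <= r / 2,
    covers (H ++ S) (d * r / 2) (A `&` cball x (r / 2)) &
    forall c, c \in S ->
      mass mu c (L * (d * r)) <= (N ^ a)%:R * e * mass mu x (L * r)].
Proof.
move=> L1 d0 r0 e0 M0 Ld La db hM.
have L0 : 0 < L by lra.
have dr0 : 0 < d * r by rewrite mulr_gt0.
have Ldr : (L + 1) * (d * r) <= r / 2 by rewrite mulrA; nra.
pose Y := [set y | mdist x y <= r /\ e * mass mu x (L * r) < mass mu y (d * r)].
pose G := [set c | exists2 y, Y y & mdist c y <= L * (d * r)].
have [||s sM covY] := @maximal_packing_covers _ _ Y (d * r) (Num.truncn M).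
- exact: ltW.
- move=> s us sY ts; rewrite truncn_ge_nat//.
  by apply: hom_at_packing_size hM us _ ts => c /sY.
pose A' := A `&` cball x (r / 2).
have r20 : 0 < r / 2 by lra.
have [|S [SN SA covS]] :=
    @ball_covers_recentre _ _ N b x (r / 2) (A' `\` G) cov r20.
  by move=> y [[]].
have big0 : 0 < (L + 3) * (d * r) by rewrite mulr_gt0//; lra.
have cz z := @ball_covers_recentre _ _ N a z _ (A' `&` cball z ((L + 3) * (d * r)))
  cov big0 (@subIsetr _ _ _).
have [f fP] := choice cz.
exists (flatten [seq f z | z <- s]), S; split => //.
- rewrite size_flatten /shape -map_comp sumnE big_map.
  apply: (@le_trans _ _ ((N ^ a)%:R * (size s)%:R)); last first.
    rewrite ler_wpM2l// (le_trans (_ : _ <= (Num.truncn M)%:R))// ?ler_nat//.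
    by rewrite truncn_le.
  rewrite -natrM ler_nat mulnC.
  have -> : (size s * N ^ a = \sum_(z <- s) N ^ a)%N.
    by rewrite big_const_seq count_predT iter_addn_0 mulnC.
  by apply: leq_sum => z _; case: (fP z).
- move=> c; rewrite mem_cat => /orP[/flatten_mapP[z zs]|/SA[[]]//].
  by case: (fP z) => _ + _ => /[apply] -[[]].
- move=> y A'y; have [[w Yw yw]|nG] := pselect (G y).
    have [z zs zw] := covY _ Yw.
    have [_ _ /(_ y)] := fP z; case.
      (* d(z, y) <= d(z, w) + d(w, y) <= 2 d r + L d r *)
      split=> //; rewrite /cball/=.
      apply: le_trans (metric_triangle _ w _) _.
      by rewrite (metric_sym w y); lra.
    move=> c cf cy; exists c.
      by rewrite mem_cat; apply/orP; left; apply/flatten_mapP; exists z.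
    apply: le_trans cy _.
    rewrite -mulr_natr mulrAC ler_pdivrMr ?exprn_gt0//; nra.
  have [|c cS cy] := covS y; first by split.
  exists c; first by rewrite mem_cat cS orbT.
  apply: le_trans cy _.
  rewrite -mulr_natr mulrAC ler_pdivrMr ?exprn_gt0//; nra.
- move=> c /SA[[Ac xc] nG]; apply: light_mass_le => //.
    by apply: le_trans La; lra.
  move=> y cy; rewrite leNgt; apply/negP => heavy; apply: nG; exists y => //.
  split=> //; apply: le_trans (metric_triangle _ c _) _.
  have := xc; rewrite /cball/=; lra.
Qed.

(** Along the covering tree the sum of mass^p gains at most the factor G per
    generation: the heavy children number at most C M and weigh no more than
    their parent, and the light ones are so light that the p-th powers of their
    masses add up to little.  At generation k only balls of mass at most beta
    matter, and for these mass <= beta^(1-p) mass^p. *)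
Lemma thin_points_le (A : set X) (L d e M G r0 p : R) a b : 0 < p -> p < 1 ->
    1 <= L -> 0 < d -> d <= 1 -> 0 <= e -> 0 <= M ->
    (L + 1) * d <= 1 / 2 -> (L + 3) * 4 <= 2 ^+ a -> 2 <= d * 2 ^+ b ->
    (N ^ a)%:R * M + (N ^ b)%:R * ((N ^ a)%:R * e) `^ p <= G ->
    A `<=` low_hom mu L d e M r0 ->
  forall k x (r beta : R), A x -> 0 < r < r0 -> 0 <= beta ->
  (mu (thin_points mu A x (r / 2)%R ((L + 1) * (d ^+ k * r))%R beta)
   <= (G ^+ k * beta `^ (1 - p) * mass mu x (L * r) `^ p)%:E)%E.
Proof.
move=> p0 p1 L1 d0 d1 e0 M0 Ld La db MG hM.
elim=> [|k IH] x r beta Ax /andP[r0' rr0] beta0.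
  set F := (X in mu X); have [->|/set0P[y [Ay xy yb]]] := eqVneq F set0.
    by rewrite outer_measure0 lee_fin !mulr_ge0// ?powR_ge0.
  (* a single thin point y makes the whole ball light,
     since B(x, L r) lies in B(y, (L + 1) r) *)
  rewrite expr0 mul1r in yb *.
  have xb : mass mu x (L * r) <= beta.
    apply: le_trans yb; apply: le_mass; rewrite (metric_sym y x); nra.
  have x0 := mass_ge0 x (L * r).
  apply: (@le_trans _ _ (mass mu x (L * r))%:E).
    rewrite -massE; apply: le_outer_measure => z [_ xz _].
    rewrite /cball/=; nra.
  rewrite lee_fin -[leLHS]powRr1// -[X in _ `^ X](subrK p) powRD; last first.
    by rewrite subrK oner_eq0.
  rewrite expr0 mul1r ler_wpM2r ?powR_ge0// ge0_ler_powR// ?nnegrE//; lra.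
have [H [S [HM SN HSA covHS light]]] :=
  @heavy_light_cover A L d e M r x a b L1 d0 r0' e0 M0 Ld La db
    (hM _ Ax r (introT andP (conj r0' rr0))).
set P := mass mu x (L * r); set F := (X in mu X).
have dr : 0 < d * r < r0.
  by rewrite mulr_gt0//= (le_lt_trans _ rr0)// ler_piMl// ltW.
pose g c := G ^+ k * beta `^ (1 - p) * mass mu c (L * (d * r)) `^ p.
have step c : c \in H ++ S ->
  (mu (thin_points mu A c (d * r / 2)%R ((L + 1) * (d ^+ k * (d * r)))%R beta)
   <= (g c)%:E)%E.
  by move=> /HSA[Ac _]; exact: IH.
apply: le_trans (outer_measure_seq_le _ step) _.
  move=> y [Ay xy yb]; have [c cHS cy] := covHS y (conj Ay xy).
  exists c => //; split=> //.
  by rewrite (mulrA (d ^+ k)) -exprSr.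
have G0 : 0 <= G.
  by apply: le_trans MG; rewrite addr_ge0 ?mulr_ge0 ?powR_ge0.
have gb c u : c \in H ++ S -> mass mu c (L * (d * r)) <= u ->
    g c <= G ^+ k * beta `^ (1 - p) * u `^ p.
  move=> cHS cu; rewrite ler_wpM2l ?mulr_ge0 ?exprn_ge0 ?powR_ge0//.
  by rewrite ge0_ler_powR ?nnegrE ?mass_ge0 ?(ltW p0)// (le_trans (mass_ge0 _ _) cu).
set K := G ^+ k * beta `^ (1 - p).
have K0 : 0 <= K by rewrite mulr_ge0 ?exprn_ge0 ?powR_ge0.
have sumc (s : seq X) u : {subset s <= H ++ S} ->
    (forall c, c \in s -> g c <= u) -> \sum_(c <- s) g c <= (size s)%:R * u.
  move=> sHS gu; apply: (@le_trans _ _ (\sum_(c <- s) u)).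
    by rewrite !big_seq; apply: ler_sum => c; exact: gu.
  by rewrite big_const_seq count_predT iter_addr addr0 mulr_natl.
rewrite lee_fin big_cat/= exprS.
have Hle : \sum_(c <- H) g c <= (N ^ a)%:R * M * (K * P `^ p).
  apply: le_trans (sumc H (K * P `^ p) _ _) _.
  - by move=> c cH; rewrite mem_cat cH.
  - move=> c cH; have cHS : c \in H ++ S by rewrite mem_cat cH.
    apply: gb => //; apply: le_mass.
    have [_ xc] := HSA _ cHS; nra.
  - by rewrite ler_wpM2r// mulr_ge0// powR_ge0.
have Sle : \sum_(c <- S) g c <= (N ^ b)%:R * ((N ^ a)%:R * e) `^ p * (K * P `^ p).
  apply: le_trans (sumc S (K * ((N ^ a)%:R * e * P) `^ p) _ _) _.
  - by move=> c cS; rewrite mem_cat cS orbT.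
  - by move=> c cS; apply: gb; [rewrite mem_cat cS orbT|exact: light].
  - rewrite powRM ?mulr_ge0// ?mass_ge0//.
    rewrite [leLHS](_ : _ = (size S)%:R * ((N ^ a)%:R * e) `^ p * (K * P `^ p)); last by ring.
    by rewrite 2?ler_wpM2r ?ler_nat ?mulr_ge0 ?powR_ge0 ?exprn_ge0.
rewrite -!mulrA (mulrA (G ^+ k)) -/K.
apply: le_trans (lerD Hle Sle) _.
by rewrite -mulrDl ler_wpM2r// mulr_ge0// powR_ge0.
Qed.

(** The geometric scales tau k = (L+1) d^k r are enough to see thinness at
    every small radius: if tau (k+1) < rho <= tau k, then
    mass (tau (k+1)) <= rho^t <= (tau k)^t.  Hence beta k below is (tau k / d)^t,
    that is, (tau (k-1))^t. *)
Lemma frequently_thin_null (L d e M G r0 p t : R) a b :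
    0 < p -> p < 1 -> 0 < t -> 0 < r0 ->
    1 <= L -> 0 < d -> 0 <= e -> 0 <= M ->
    (L + 1) * d <= 1 / 2 -> (L + 3) * 4 <= 2 ^+ a -> 2 <= d * 2 ^+ b ->
    (N ^ a)%:R * M + (N ^ b)%:R * ((N ^ a)%:R * e) `^ p <= G ->
    G * d `^ (t * (1 - p)) < 1 ->
  mu (low_hom mu L d e M r0 `&` frequently_thin mu t) = 0%E.
Proof.
move=> p0 p1 t0 r00 L1 d0 e0 M0 Ld La db MG Gd; set A := low_hom _ _ _ _ _ _.
have d1 : d < 1 by nra.
have G0 : 0 <= G.
  by apply: le_trans MG; rewrite addr_ge0 ?mulr_ge0 ?powR_ge0.
pose r := r0 / 2; have r0' : 0 < r by rewrite divr_gt0.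
have rr0 : r < r0 by rewrite /r; lra.
pose tau k := (L + 1) * (d ^+ k * r).
have tau0 k : 0 < tau k by rewrite !mulr_gt0 ?exprn_gt0//; lra.
have tauS k n : (k <= n)%N -> tau n <= tau k.
  move=> kn; rewrite ler_wpM2l ?ler_wpM2r ?(ltW r0')//; first lra.
  by rewrite ler_wiXn2l ?ltW.
pose beta k := (tau k / d) `^ t.
have betaE k : beta k `^ (1 - p) =
    ((L + 1) * r / d) `^ (t * (1 - p)) * (d `^ (t * (1 - p))) ^+ k.
  rewrite /beta -powRrM; move: (t * (1 - p)) => u.
  rewrite -powR_mulrn ?powR_ge0// -powRrM (mulrC u) powRrM.
  rewrite powR_mulrn ?(ltW d0)// -powRM; first by congr powR; rewrite /tau; ring.
    by rewrite !mulr_ge0 ?invr_ge0; lra.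
  by rewrite exprn_ge0// ltW.
have near_centre x : A x ->
    mu (A `&` frequently_thin mu t `&` cball x (r / 2)) = 0%E.
  move=> Ax; pose F k := thin_points mu A x (r / 2) (tau k) (beta k).
  apply: outer_measure_le0; rewrite -(@outer_measure_borel_cantelli _ _ mu F
    (((L + 1) * r / d) `^ (t * (1 - p)) * mass mu x (L * r) `^ p)
    (G * d `^ (t * (1 - p)))) ?mulr_ge0 ?powR_ge0//; last first.
    move=> k.
    have /(_ k x r (beta k) Ax) := @thin_points_le A L d e M G r0 p a b
      p0 p1 L1 d0 (ltW d1) e0 M0 Ld La db MG (@subset_refl _ _).
    rewrite r0' rr0 powR_ge0 => /(_ isT isT).
    move=> /le_trans; apply; rewrite lee_fin betaE exprMn le_eqVlt; apply/orP; left.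
    by apply/eqP; ring.
  apply: le_outer_measure => y [[Ay thin] xy] n.
  have [rho /andP[rho0 rhon] mrho] := thin _ (tau0 n).
  have exk : exists k, tau k.+1 < rho.
    have [|k dk] := @exists_expr_lt R d (rho / ((L + 1) * r)) (ltW d0) d1.
      by rewrite divr_gt0// mulr_gt0//; lra.
    exists k; rewrite (le_lt_trans (tauS k k.+1 (leqnSn k)))//.
    by move: dk; rewrite ltr_pdivlMr /tau ?mulr_gt0//; [nra|lra].
  have [k tk kmin] := ex_minnP exk.
  have nk : (n <= k)%N.
    rewrite leqNgt; apply/negP => kn.
    by have := lt_trans tk rhon; rewrite ltNge tauS.
  exists k.+1; first exact: leqW.
  split=> //; rewrite (le_trans (@le_mass _ y _ rho _))//.
    by rewrite mdistxx add0r ltW.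
  apply: le_trans (ltW mrho) _.
  rewrite /beta ge0_ler_powR// ?nnegrE ?(ltW t0) ?(ltW rho0)//.
    by rewrite divr_ge0// ltW.
  rewrite (_ : tau k.+1 / d = tau k); last first.
    by rewrite /tau exprSr; field; rewrite gt_eqF.
  case: k tk kmin nk => [|k] tk kmin nk.
    by rewrite (le_trans (ltW rhon))// tauS.
  by rewrite leNgt; apply/negP => /kmin; rewrite ltnn.
have [->|/set0P[x0 _]] := eqVneq A set0; first by rewrite set0I outer_measure0.
pose W m := A `&` frequently_thin mu t `&` cball x0 m.+1%:R.
have W0 m : mu (W m) = 0%E.
  have [j jm] : exists j, (1 / 2 : R) ^+ j < r / 2 / (m.+1%:R * 2).
    by apply: exists_expr_lt; rewrite ?divr_gt0// ?mulr_gt0//; lra.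
  have m0 : 0 < m.+1%:R :> R by [].
  have [|s [_ sA covs]] := @ball_covers_recentre _ _ N j x0 m.+1%:R
      (A `&` cball x0 m.+1%:R) cov m0; first exact: subIsetr.
  apply: outer_measure_le0.
  rewrite (_ : 0%E = (\sum_(c <- s) (0 : R))%:E); last by rewrite big1.
  apply: (@outer_measure_seq_le _ _ mu s
    (fun c => A `&` frequently_thin mu t `&` cball c (r / 2))).
    move=> y [[Ay yt] xy]; have [c cs cy] := covs y (conj Ay xy).
    exists c => //; split; first by split.
    apply: le_trans cy _; move: jm; rewrite ltr_pdivlMr ?mulr_gt0// => /ltW.
    apply: le_trans; rewrite expr_div_n expr1n le_eqVlt; apply/orP; left.
    by apply/eqP; ring.
  by move=> c /sA[Ac _]; rewrite near_centre.
have -> : A `&` frequently_thin mu t = \bigcup_m W m.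
  apply/seteqP; split => [y Ay|y [m _ []]//].
  exists (Num.truncn (mdist x0 y)) => //; split=> //.
  by apply: ltW; rewrite truncnS_gt.
exact: outer_measure_bigcup0.
Qed.

Lemma exists_le_expr2 (u : R) : exists a, u <= 2 ^+ a.
Proof.
exists (Num.truncn u).+1; apply: le_trans (ltW (truncnS_gt u)) _.
by rewrite -natrX ler_nat ltnW// ltn_expl.
Qed.

(** Choice of the constants.  The exponent p = (t-s)/(2t) makes
    t (1-p) = (s+t)/2 exceed s, so that G d^(t(1-p)), with G = 2 C M and
    M = (d/2)^(-s), is a constant times d^((t-s)/2), which is small with d.  The
    number e is the one for which heavy and light balls contribute equally. *)
Lemma low_hom_null (L s t : R) : (0 < N)%N -> 1 <= L -> 0 < s -> s < t ->
  exists2 d0 : R, 0 < d0 & forall d, 0 < d < d0 ->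
  exists2 e : R, 0 < e & forall r0 : R, 0 < r0 ->
    mu (low_hom mu L d e ((d / 2) `^ (- s)) r0 `&` frequently_thin mu t) = 0%E.
Proof.
move=> N0 L1 s0 st.
have t0 : 0 < t by lra.
have [a La] := exists_le_expr2 ((L + 3) * 4).
pose C : R := (N ^ a)%:R; have C0 : 0 < C by rewrite ltr0n expn_gt0 N0.
pose p := (t - s) / (2 * t).
have p0 : 0 < p by rewrite divr_gt0//; lra.
have p1 : p < 1 by rewrite ltr_pdivrMr; lra.
have tp : t * (1 - p) = s + (t - s) / 2 by rewrite /p; field; rewrite gt_eqF.
pose h := (t - s) / 2; have h0 : 0 < h by rewrite /h; lra.
pose K := 2 * C * 2 `^ s.
have K0 : 0 < K by rewrite !mulr_gt0 ?powR_gt0.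
exists (Num.min (1 / 2 / (L + 1)) (K^-1 `^ h^-1)).
  by rewrite lt_min !divr_gt0 ?powR_gt0 ?invr_gt0//; lra.
move=> d /andP[d0]; rewrite lt_min => /andP[dL dK].
pose M := (d / 2) `^ (- s); have M0 : 0 < M by rewrite powR_gt0// divr_gt0.
have [b db] := exists_le_expr2 (2 / d).
pose B : R := (N ^ b)%:R; have B0 : 0 < B by rewrite ltr0n expn_gt0 N0.
exists ((C * M / B) `^ p^-1 / C).
  by rewrite divr_gt0// powR_gt0// !mulr_gt0// invr_gt0.
move=> r0 r00.
apply: (@frequently_thin_null L d
  ((C * M / B) `^ p^-1 / C) M (2 * C * M) r0 p t a b) => //.
- by rewrite divr_ge0 ?powR_ge0// ltW.
- exact: ltW.
- by move: dL; rewrite ltr_pdivlMr; lra.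
- by move: db; rewrite ler_pdivrMr// mulrC.
- rewrite -/C -/B mulrC (mulrC C) divfK ?gt_eqF// -powRrM mulVf ?gt_eqF//.
  rewrite powRr1; last by rewrite ltW// divr_gt0// mulr_gt0.
  by rewrite mulrC mulrCA divff ?gt_eqF// le_eqVlt; apply/orP; left; apply/eqP; ring.
- have -> : 2 * C * M * d `^ (t * (1 - p)) = K * d `^ h.
    rewrite tp powRD; last by rewrite (gt_eqF d0) implybT.
    have ds : d `^ s != 0 by rewrite gt_eqF ?powR_gt0.
    have -> : M = 2 `^ s / d `^ s.
      rewrite /M powRN powRM ?invr_ge0 ?(ltW d0)// -(powR_inv1 (ler0n _ 2)).
      by rewrite powRAC powR_inv1 ?powR_ge0// invfM invrK mulrC.
    by rewrite /K /h; field.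
  have : d `^ h < K^-1.
    rewrite -[ltRHS](powRr1) ?invr_ge0 ?(ltW K0)// -(mulVf (lt0r_neq0 h0)) [ltRHS]powRrM.
    by apply: gt0_ltr_powR => //; rewrite nnegrE ?powR_ge0// ltW.
  by rewrite -[K^-1]mul1r ltr_pdivlMr// mulrC.
Qed.

End Branching.

(** * Upper and lower limits at 0 *)

Lemma at_right0P (R : realType) (V : set R) :
  0^'+ V -> exists2 eta : R, 0 < eta & forall r, 0 < r < eta -> V r.
Proof.
move=> [eta /= eta0 etaV]; exists eta => // r /andP[r0 re].
by apply: etaV => //=; rewrite sub0r normrN gtr0_norm.
Qed.

Lemma at_right0_itv (R : realType) (eta : R) : 0 < eta ->
  0^'+ [set r : R | 0 < r < eta].
Proof.
move=> eta0; exists eta => //= r /=; rewrite sub0r normrN => re r0.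
by rewrite r0 -(gtr0_norm r0).
Qed.

Lemma limf_esup0_gt (R : realType) (f : R -> \bar R) (t : \bar R) :
  (t < limf_esup f 0^'+)%E ->
  forall eta : R, 0 < eta -> exists2 r, 0 < r < eta & (t < f r)%E.
Proof.
move=> tf eta eta0.
have : (t < ereal_sup (f @` [set r : R | (0 < r < eta)%R]))%E.
  apply: lt_le_trans tf _; apply: ereal_inf_lbound.
  by exists [set r : R | 0 < r < eta] => //; exact: at_right0_itv.
by move=> /ereal_sup_gt[_ [r rI <-] tr]; exists r.
Qed.

Lemma limf_esup0_lt (R : realType) (f : R -> \bar R) (t : \bar R) :
  (limf_esup f 0^'+ < t)%E ->
  exists2 eta : R, 0 < eta & forall r, 0 < r < eta -> (f r <= t)%E.
Proof.
move=> /ereal_inf_lt[_ [V /at_right0P[eta eta0 etaV] <-] Vt].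
exists eta => // r /etaV Vr; apply: le_trans (ltW Vt).
by apply: ereal_sup_ubound; exists r.
Qed.

Lemma limf_einf0_lt (R : realType) (f : R -> \bar R) (t : \bar R) :
  (limf_einf f 0^'+ < t)%E ->
  forall eta : R, 0 < eta -> exists2 r, 0 < r < eta & (f r < t)%E.
Proof.
rewrite /limf_einf lteNl => /limf_esup0_gt + eta eta0.
by move=> /(_ _ eta0)[r rI]; rewrite lteN2; exists r.
Qed.

(** * From dimensions to balls *)

Section Dimensions.
Context {R : realType} {X : metricType R} (mu : {outer_measure set X -> \bar R}).
Implicit Types (L d e r s t : R) (x : X).

Lemma hom_at_ge0 L d e r x : (0 <= hom_at mu L d e r x)%E.
Proof.
apply: ereal_sup_ubound; exists [set` ([::] : seq X)].
  split=> //; split=> //.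
  by apply: finite_set_countable; exact: finite_seq.
exact: (@counting_seq R X [::]).
Qed.

Lemma hom_at_gt0_ge1 L d e r x :
  (0 < hom_at mu L d e r x)%E -> (1 <= hom_at mu L d e r x)%E.
Proof.
move=> /ereal_sup_gt[_ [C CP <-] C0].
apply: (@le_trans _ _ (counting C)); last first.
  by apply: ereal_sup_ubound; exists C.
move: C0; rewrite /counting; case: ifPn; rewrite ?leey//.
by rewrite lte_fin lee_fin ltr0n ler1n.
Qed.

Lemma le_hom_at L d e r L' d' e' r' x :
  d' * r' = d * r -> r' <= r -> L * r <= L' * r' -> 0 <= e -> e <= e' ->
  (hom_at mu L' d' e' r' x <= hom_at mu L d e r x)%E.
Proof.
move=> dr rr Lr e0 ee; apply: ub_ereal_sup => _ [C [[cC CA tC] mC] <-].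
apply: ereal_sup_ubound; exists C => //; split.
  by split; rewrite -?dr// => c /CA /= /le_trans; apply.
move=> c Cc; rewrite -dr; apply: le_lt_trans (mC c Cc).
apply: lee_pmul; rewrite ?lee_fin ?outer_measure_ge0//.
by apply: le_outer_measure => y /= /le_trans; apply.
Qed.

Lemma homE L d x :
  Defs.hom mu L d x = ereal_sup
    [set limf_esup (fun r => hom_at mu L d e r x) 0^'+ | e in [set e | 0 < e]].
Proof.
pose G e := limf_esup (fun r => hom_at mu L d e r x) 0^'+.
rewrite /Defs.hom (cvg_lim _ (nonincreasing_at_right_cvge (f := G) (+oo%O) _ _))//.
  by congr (ereal_sup (_ @` _)); apply/seteqP; split=> e; rewrite /= in_itv/= andbT.
move=> e e'; rewrite !in_itv/= !andbT => e0 _ ee.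
apply: le_ereal_inf_tmp => _ [V FV <-].
apply: (@le_trans _ _ (ereal_sup ((fun r => hom_at mu L d e' r x) @` V))).
  by apply: ereal_inf_lbound; exists V.
apply: ub_ereal_sup => _ [r Vr <-].
apply: (@le_trans _ _ (hom_at mu L d e r x)).
  by apply: le_hom_at => //; exact: ltW.
by apply: ereal_sup_ubound; exists r.
Qed.

Lemma limf_esup_hom_at_ge0 L d e x :
  (0 <= limf_esup (fun r => hom_at mu L d e r x) 0^'+)%E.
Proof.
apply: limf_esup_ge0 => [|r]; last exact: hom_at_ge0.
by move=> /at_right0P[eta eta0 /(_ (eta / 2))]; apply; apply/andP; split; lra.
Qed.

Lemma hom_ge0 L d x : (0 <= Defs.hom mu L d x)%E.
Proof.
rewrite homE; apply: le_trans (limf_esup_hom_at_ge0 L d 1 x) _.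
by apply: ereal_sup_ubound; exists 1; rewrite /=.
Qed.

(** Cardinalities are integers, so hom is either 0, where log0 vanishes, or at
    least 1. *)
Lemma log0_hom_ge0 L d x : (0 <= log0 (Defs.hom mu L d x))%E.
Proof.
rewrite /log0; case: eqP => // /eqP hom0; rewrite lne_ge0.
have : (0 < Defs.hom mu L d x)%E.
  by rewrite lt_neqAle eq_sym hom0 hom_ge0.
rewrite homE => /ereal_sup_gt[_ [e e0 <-] pos].
apply: (@le_trans _ _ (limf_esup (fun r => hom_at mu L d e r x) 0^'+)).
  apply: le_ereal_inf_tmp => _ [V /at_right0P[eta eta0 etaV] <-].
  have [r rI /hom_at_gt0_ge1 h1] := limf_esup0_gt pos eta0.
  by apply: le_trans h1 _; apply: ereal_sup_ubound; exists r => //; exact: etaV.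
by apply: ereal_sup_ubound; exists e.
Qed.

Lemma dim_hom_ge0 L x : (0 <= dim_hom mu L x)%E.
Proof.
rewrite leNgt; apply/negP => /limf_einf0_lt /(_ 1 ltr01)[d /andP[d0 d1]].
apply/negP; rewrite -leNgt; apply: mule_ge0; first exact: log0_hom_ge0.
by rewrite inve_ge0 lee_fin oppr_ge0 ln_le0// ltW.
Qed.

Lemma dim_hom_lt L x s : (dim_hom mu L x < s%:E)%E -> forall eta : R, 0 < eta ->
  exists2 d, 0 < d < eta & (Defs.hom mu L d x < (d `^ (- s))%:E)%E.
Proof.
move=> /limf_einf0_lt hs eta eta0.
have [|d /andP[d0]] := hs (Num.min eta 1); first by rewrite lt_min eta0/=.
rewrite lt_min => /andP[de d1] hd; exists d; first by rewrite d0.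
move: hd; rewrite /log0; case: eqP => [->|/eqP hn0].
  by rewrite lte_fin powR_gt0.
have lnd : 0 < - ln d by rewrite oppr_gt0 ln_lt0// d0.
rewrite inver gt_eqF// lte_pdivrMr// -EFinM => hd.
have -> : (d `^ (- s))%:E = expeR (s * - ln d)%:E.
  by rewrite /= /powR gt_eqF//; congr (expR _)%:E; ring.
by rewrite -[ltLHS]lneK ?lte_expeR// in_itv/= hom_ge0 leey.
Qed.

Lemma upper_local_dim_frequently_thin x t :
  (forall x r, (mu (cball x r) < +oo)%E) ->
  (t%:E < upper_local_dim mu x)%E -> frequently_thin mu t x.
Proof.
move=> finb /limf_esup0_gt ht eta eta0.
have [|r /andP[r0]] := ht (Num.min eta 1); first by rewrite lt_min eta0/=.
rewrite lt_min => /andP[re r1] hr; exists r; first by rewrite r0.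
move: hr; rewrite massE//; have := mass_ge0 finb x r.
rewrite le_eqVlt => /predU1P[<- _|m0]; first by rewrite powR_gt0.
have lnr : ln r < 0 by rewrite ln_lt0// r0.
rewrite lne_EFin// inver lt_eqF// -EFinM lte_fin ltr_ndivlMr//.
by rewrite -ln_powR ltr_ln// posrE powR_gt0.
Qed.

(** A packing of B(x,r) by balls of radius d r also is a packing of
    B(x,(d/del) r) by balls of radius del times the radius of that ball.  As
    d/del < 2, the reference ball of radius 2 L r contains the one of radius
    L (d/del) r, which is why L is doubled. *)
Lemma hom_lt_low_hom L del d e s x : 0 < L -> 0 < del -> 0 < e -> 0 < s ->
    del < d -> d < 2 * del -> (Defs.hom mu L del x < (del `^ (- s))%:E)%E ->
  exists n, low_hom mu (2 * L) d e ((d / 2) `^ (- s)) n.+1%:R^-1 x.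
Proof.
move=> L0 del0 e0 s0 deld d2 homdel.
have [r0 r00 homr] : exists2 r0 : R, 0 < r0 & forall r, 0 < r < r0 ->
    (hom_at mu L del e r x <= (del `^ (- s))%:E)%E.
  apply: limf_esup0_lt; apply: le_lt_trans homdel.
  by rewrite homE; apply: ereal_sup_ubound; exists e.
exists (Num.truncn (2 / r0)) => r /andP[r_gt0 rn].
have rr0 : 2 * r < r0.
  have := truncnS_gt (2 / r0); rewrite ltr_pdivrMr// => h.
  move: rn; rewrite -[_^-1]mul1r ltr_pdivlMr// => rn; nra.
have dd : 1 < d / del by rewrite ltr_pdivlMr// mul1r.
have dd2 : d / del < 2 by rewrite ltr_pdivrMr.
apply: (@le_trans _ _ (hom_at mu L del e (d / del * r) x)).
  apply: le_hom_at => //.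
  - by field; rewrite gt_eqF.
  - by nra.
  - by rewrite mulrA ler_wpM2r ?(ltW r_gt0)//; nra.
  - exact: ltW.
apply: le_trans (homr _ _) _; first by apply/andP; split; nra.
have d0 : 0 < d / 2 by lra.
rewrite lee_fin !powRN lef_pV2 ?posrE ?powR_gt0//.
rewrite ge0_ler_powR// ?nnegrE; lra.
Qed.

End Dimensions.

Theorem theorem3p5 (R : realType) (X : metricType R)
    (mu : {outer_measure set X -> \bar R}) (Lambda : R) :
  doubling X -> is_measure_on mu -> 1 < Lambda ->
  mu [set x : X | ~ (upper_local_dim mu x <= dim_hom mu Lambda x)%E] = 0%E.
Proof.
move=> dX [mu0 _ mub] L1.
have finb x r : (mu (cball x r) < +oo)%E by apply: mub; exists x, r.
have [N cov] := doubling_ball_covers dX.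
have N0 : (0 < N)%N.
  rewrite lt0n; apply/negP => /eqP NE; move/eqP: mu0; apply.
  rewrite (_ : [set: X] = set0) ?outer_measure0//; apply/seteqP; split => // x _.
  have [s + cs] := cov 1%N x 1 ltr01.
  rewrite NE exp0n// leqn0 size_eq0 => /eqP s0.
  by have [|c] := cs x; rewrite /cball/= ?mdistxx// s0.
have LL : 1 <= 2 * Lambda by lra.
(* a threshold D (s, t) for d, and an epsilon E (s, t, d) for each d below it,
   fixed in advance so that the exceptional sets depend on rationals only *)
have /choice[D DP] : forall st : R * R, exists d0 : R, 0 < st.1 < st.2 ->
    0 < d0 /\ forall d, 0 < d < d0 ->
    exists2 e : R, 0 < e & forall r0 : R, 0 < r0 ->
      mu (low_hom mu (2 * Lambda) d e ((d / 2) `^ (- st.1)) r0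
          `&` frequently_thin mu st.2) = 0%E.
  move=> [s t] /=; have [/andP[s0 st]|nst] := boolP (0 < s < t); last by exists 0.
  by have [d0 ? ?] := low_hom_null finb cov N0 LL s0 st; exists d0.
have /choice[E EP] : forall std : R * R * R, exists e : R,
    0 < std.1.1 < std.1.2 -> 0 < std.2 < D std.1 ->
    0 < e /\ forall r0 : R, 0 < r0 ->
      mu (low_hom mu (2 * Lambda) std.2 e ((std.2 / 2) `^ (- std.1.1)) r0
          `&` frequently_thin mu std.1.2) = 0%E.
  move=> [st d] /=; have [stI|] := boolP (0 < st.1 < st.2); last by exists 0.
  have [dI|] := boolP (0 < d < D st); last by exists 0.
  by have [_ /(_ d dI)[e ? ?]] := DP st stI; exists e.
pose F (i : rat * rat * rat * nat) := let: (qs, qt, qd, n) := i in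
  let s : R := ratr qs in let t : R := ratr qt in let d : R := ratr qd in
  [set x | [/\ 0 < s < t, 0 < d < D (s, t),
    low_hom mu (2 * Lambda) d (E (s, t, d)) ((d / 2) `^ (- s)) n.+1%:R^-1 x
    & frequently_thin mu t x]].
apply: outer_measure_le0; rewrite -(@outer_measure_bigcup0 _ _ _ mu F); last first.
  move=> [[[qs qt] qd] n] /=.
  set s : R := ratr qs; set t : R := ratr qt; set d : R := ratr qd.
  have [stI|nst] := boolP (0 < s < t); last first.
    rewrite (_ : [set x | _] = set0) ?outer_measure0//.
    by apply/seteqP; split=> x // [].
  have [dI|nd] := boolP (0 < d < D (s, t)); last first.
    rewrite (_ : [set x | _] = set0) ?outer_measure0//.
    by apply/seteqP; split=> x // [].
  have [_ null] := EP (s, t, d) stI dI.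
  apply: outer_measure_le0; rewrite -(null n.+1%:R^-1) ?invr_gt0//.
  by apply: le_outer_measure => x [].
apply: le_outer_measure => x /= /negP; rewrite -ltNge => lt_dim.
have hom0 := dim_hom_ge0 mu Lambda x.
have [u uE] : exists u, dim_hom mu Lambda x = u%:E.
  case: dim_hom hom0 lt_dim => [u _ _|_|//]; first by exists u.
  by rewrite ltNge leey.
rewrite uE lee_fin in lt_dim hom0 *.
have [v uv vle] : exists2 v : R, u < v & (v%:E <= upper_local_dim mu x)%E.
  case: upper_local_dim lt_dim => [v|_|] //; first by rewrite lte_fin; exists v.
  by exists (u + 1); rewrite ?ltrDl ?leey.
have [qt] := rat_in_itvoo uv; rewrite in_itv/= => /andP[ut tv].
have [qs] := rat_in_itvoo ut; rewrite in_itv/= => /andP[us st].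
move: ut tv us st; set s : R := ratr qs; set t : R := ratr qt => ut tv us st.
have s0 : 0 < s by exact: le_lt_trans us.
have stI : 0 < s < t by rewrite s0 st.
have [D0 _] := DP (s, t) stI.
have [||del /andP[del0 delD] homdel] := @dim_hom_lt _ _ mu Lambda x s _ (D (s, t) / 2).
- by rewrite uE lte_fin.
- by rewrite divr_gt0.
have [|qd] := @rat_in_itvoo R del (2 * del); first lra.
rewrite in_itv/=; set d : R := ratr qd => /andP[deld d2].
have dI : 0 < d < D (s, t) by apply/andP; split; lra.
have [e0 _] := EP (s, t, d) stI dI.
have [|n low] := hom_lt_low_hom _ del0 e0 s0 deld d2 homdel; first lra.
exists (qs, qt, qd, n) => //=; split=> //.
apply: upper_local_dim_frequently_thin => //; apply: lt_le_trans vle.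
by rewrite lte_fin.
Qed.
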